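(* Let $k$ be a field, let $A$ and $E$ be sets and let $f\colon E\to k^A$ be a map. If $M_{ts}^{\mathrm{co}}(f)$ satisfies (IM), then $$(M_{ts}^{\mathrm{co}}(f))^*=M_{ts}(f).$$ In particular, $M_{ts}(f)$ is a matroid.
   Context: A matroid $M$ consists of a (possibly infinite) ground set $E$ and a set $\mathcal I$ of subsets of $E$ (the independent sets) such that: (I1) $\emptyset\in\mathcal I$; (I2) $\mathcal I$ is closed under taking subsets; (I3) for every non-maximal $I\in\mathcal I$ and every maximal $I'\in\mathcal I$ there is $x\in I'\setminus I$ with $I\cup\{x\}\in\mathcal I$; (IM) whenever $I\subseteq X\subseteq E$ and $I\in\mathcal I$, the set $\{I'\in\mathcal I : I\subseteq I'\subseteq X\}$ has a maximal element. Bases are maximal independent sets. The dual $M^*$ is the matroid on $E$ whose bases are the complements of the bases of $M$. (The displayed equation is understood to include the assertion that $M_{ts}^{\mathrm{co}}(f)$ is a matroid, so that its dual is defined.) A thin dependence of $f\colon E\to k^A$ is a map $c\colon E\to k$ such that for each $a\in A$ we have $\sum_{e\in E}c(e)f(e)(a)=0$ (including the requirement that, for each $a$, only finitely many summands are nonzero). The thin sums system $M_{ts}(f)$ is the set system on $E$ in which a subset is independent iff there is no nonzero thin dependence of $f$ that is zero outside that subset. A subset $I\subseteq E$ is coindependent (for $f$) iff for every $i\in I$ there is a thin dependence $d_i$ of $f$ such that $d_i(i)=1$ and $d_i$ is $0$ on $I\setminus\{i\}$. The set system $M_{ts}^{\mathrm{co}}(f)$ has ground set $E$, and its independent sets are the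 coindependent subsets of $E$. *)

(* Defs.v *)
From mathcomp Require Import all_boot all_order all_algebra.
From mathcomp Require Import boolp classical_sets functions cardinality fsbigop.

Set Implicit Arguments.
Unset Strict Implicit.
Unset Printing Implicit Defensive.

Import GRing.Theory.
Local Open Scope classical_set_scope.
Local Open Scope ring_scope.

(* A set system on the ground set E is given by its family of independent
   sets, an element of set (set E). *)

Definition inclusion_maximal (E : Type) (S : set (set E)) (B : set E) : Prop :=
  S B /\ forall C, S C -> B `<=` C -> C = B.

Definition bases (E : Type) (M : set (set E)) : set (set E) :=
  [set B | inclusion_maximal M B].

Definition axiom_IM (E : Type) (M : set (set E)) : Prop :=
  forall I X : set E, M I -> I `<=` X ->
    exists B, inclusion_maximal [set I' | [/\ M I', I `<=` I' & I' `<=` X]] B.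

Record is_matroid (E : Type) (M : set (set E)) : Prop := IsMatroid {
  matroid_I1 : M set0;
  matroid_I2 : forall I J : set E, M J -> I `<=` J -> M I;
  matroid_I3 : forall I I' : set E, M I -> ~ inclusion_maximal M I ->
    inclusion_maximal M I' ->
    exists x, [/\ I' x, ~ I x & M (I `|` [set x])];
  matroid_IM : axiom_IM M
}.

(* The independent sets of the dual are the subsets of complements of bases;
   [bases_dual] checks that its bases are exactly these complements. *)
Definition dual (E : Type) (M : set (set E)) : set (set E) :=
  [set X | exists2 B, bases M B & X `<=` ~` B].

Lemma bases_dual (E : Type) (M : set (set E)) :
  bases (dual M) = [set ~` B | B in bases M].
Proof.
apply/seteqP; split=> [X [[B MB XB] Xmax]|_ [B MB <-]].
  by exists B => //; apply: Xmax => //; exists B.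
split=> [|C [B' MB' CB'] BC]; first by exists B.
have B'B : B' `<=` B by rewrite -setCS; exact: subset_trans BC CB'.
have BB' : B = B' by case: MB' => _; apply=> //; case: MB.
by apply/seteqP; split=> //; rewrite BB'.
Qed.

(* [{classic E}] is E itself; it only supplies the choice structure that finitely
   supported sums require. Such a sum is 0 when the support is infinite, hence
   the separate finiteness clause. *)
Definition thin_dependence (k : fieldType) (A E : Type) (f : E -> A -> k)
    (c : E -> k) : Prop :=
  forall a : A,
    finite_set [set e : E | c e * f e a != 0] /\
    \sum_(e \in [set: {classic E}]) c e * f e a = 0.

Definition thin_sums (k : fieldType) (A E : Type) (f : E -> A -> k) :
    set (set E) :=
  [set X | ~ exists c : E -> k,
    [/\ thin_dependence f c, exists e, c e != 0 & forall e, ~ X e -> c e = 0]].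

Definition co_thin_sums (k : fieldType) (A E : Type) (f : E -> A -> k) :
    set (set E) :=
  [set I | forall i, I i -> exists d : E -> k,
    [/\ thin_dependence f d, d i = 1 & forall j, I j -> j <> i -> d j = 0]].

(* Main.v *)
Require Import Defs.
From mathcomp Require Import all_boot all_order all_algebra.
From mathcomp Require Import boolp classical_sets functions cardinality fsbigop.

(** Call a set coindependent as in [co_thin_sums].  Apart from the general
    duality of matroids, the proof is linear algebra, and it uses only that the
    thin dependences of [f] form a linear subspace of the functions on the
    ground set ([thin_dependence_subZ]).

    If a thin dependence vanishes on a coindependent set I but not at e, then
    rescaling it gives a witness for e, and subtracting multiples of it from
    the old witnesses makes them vanish at e; so I + e is coindependent
    ([co_thin_sums_setU1]).  Hence the maximal coindependent sets are exactly
    those on which no nonzero thin dependence vanishes ([co_thin_sums_basesP]).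
    Two consequences follow.

    - Exchange: if I is coindependent but not maximal, some nonzero thin
      dependence d vanishes on I; it cannot vanish on a maximal I', and any
      point of I' where d is nonzero can be added to I.

    - Duality: if X avoids a maximal coindependent B, a thin dependence that
      is zero outside X vanishes on B, hence is zero, so X is thinly
      independent.  Conversely, for X thinly independent, (IM) gives a
      coindependent B maximal among those avoiding X.  A thin dependence
      vanishing on B must vanish on the whole complement of X (otherwise B
      could be enlarged there), hence is zero; so B is maximal outright and X
      is independent in the dual.

    It remains that the dual of a matroid is a matroid ([dual_is_matroid]).
    The tool is [base_between]: in a matroid, an independent set contained in
    a set Y that includes some base extends to a base inside Y. *)

Set Implicit Arguments.
Unset Strict Implicit.
Unset Printing Implicit Defensive.

Import GRing.Theory.
Local Open Scope classical_set_scope.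
Local Open Scope ring_scope.

(** * Duality of matroids *)

Lemma inclusion_maximal_setU1 (E : Type) (M : set (set E)) (B : set E) :
  (forall I J : set E, M J -> I `<=` J -> M I) -> M B ->
  (forall e, ~ B e -> ~ M (B `|` [set e])) -> inclusion_maximal M B.
Proof.
move=> M2 MB Bmax; split=> // C MC BC; apply/seteqP; split=> // e Ce.
apply: contrapT => nBe; apply: (Bmax e nBe).
by apply: M2 MC _ => x [/BC|->].
Qed.

Lemma notin_inclusion_maximal (E : Type) (S : set (set E)) (B : set E) e :
  inclusion_maximal S B -> ~ B e -> ~ S (B `|` [set e]).
Proof.
move=> [_ Bmax] nBe SBe; apply: nBe.
by rewrite -(Bmax _ SBe); [right | left].
Qed.

Lemma base_between (E : Type) (M : set (set E)) (S Y B0 : set E) :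
  is_matroid M -> M S -> S `<=` Y -> bases M B0 -> B0 `<=` Y ->
  exists B, [/\ bases M B, S `<=` B & B `<=` Y].
Proof.
move=> mM MS SY MB0 B0Y.
have [B Bmax] := matroid_IM mM MS SY.
have [[MB SB BY] _] := Bmax.
exists B; split=> //; apply: contrapT => nB.
have [x [B0x nBx MBx]] := matroid_I3 mM MB nB MB0.
apply: (notin_inclusion_maximal Bmax nBx); split=> //.
- by move=> y Sy; left; exact: SB.
- by move=> y [/BY//|->]; exact: B0Y.
Qed.

(** Were no exchange possible, every base disjoint from [I] would contain
    [I' `\` I].  A base disjoint from [I] that extends the part outside [I] of
    the base complementary to [I'] would then be the whole complement of [I],
    making [I] maximal. *)
Lemma dual_exchange (E : Type) (M : set (set E)) (I I' : set E) :
  is_matroid M -> dual M I -> ~ inclusion_maximal (dual M) I ->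
  inclusion_maximal (dual M) I' ->
  exists x, [/\ I' x, ~ I x & dual M (I `|` [set x])].
Proof.
move=> mM [B MB IB] nmax I'max; apply: contrapT => nex.
have BsubC : B `<=` ~` I by move=> x Bx /IB.
have: bases (dual M) I' by [].
rewrite bases_dual => -[B' MB' B'I'].
have MB'I : M (B' `\` I).
  by case: MB' => MB' _; apply: (matroid_I2 mM) MB' _ => x [].
have B'ICI : B' `\` I `<=` ~` I by move=> x [].
have [B2 [MB2 B'B2 B2I]] := base_between mM MB'I B'ICI MB BsubC.
apply: nmax; suff -> : I = ~` B2.
  by change (bases (dual M) (~` B2)); rewrite bases_dual; exists B2.
apply/seteqP; split=> [x Ix /B2I//|x nB2x].
apply: contrapT => nIx.
have nB'x : ~ B' x by move=> B'x; apply: nB2x; apply: B'B2.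
apply: nex; exists x; split=> //; first by rewrite -B'I'.
by exists B2 => // y [Iy /B2I//|->].
Qed.

(** A set [J] with [I `<=` J `<=` X] that is independent in the dual is largest
    when a complementary base meets [X] as little as possible; so a maximal
    independent set [B1] of the complement of [X] is extended to a base [B]
    disjoint from [I], and [X `\` B] is taken.  A larger [J], disjoint from a
    base [B'], would let a point of [B] in [J] be exchanged for a point of [B']
    outside [X], contradicting the maximality of [B1]. *)
Lemma dual_IM (E : Type) (M : set (set E)) :
  is_matroid M -> axiom_IM (dual M).
Proof.
move=> mM I X [B0 MB0 IB0] IX.
have [B1 B1max] := matroid_IM mM (matroid_I1 mM) (@sub0set _ (~` X)).
have [[MB1 _ B1X] _] := B1max.
have B1I : B1 `<=` ~` I by move=> x /B1X nXx /IX.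
have B0I : B0 `<=` ~` I by move=> x B0x /IB0.
have [B [MB B1B BI]] := base_between mM MB1 B1I MB0 B0I.
exists (X `\` B); split; first split.
- by exists B => // x [].
- by move=> x Ix; split; [exact: IX | move/BI].
- by move=> x [].
move=> J [[B' MB' JB'] _ JX] XBJ; apply/seteqP; split=> // y Jy.
split; [exact: JX | move=> By].
have MBy : M (B `\ y).
  by case: MB => MB _; apply: (matroid_I2 mM) MB _ => x [].
have nmax : ~ inclusion_maximal M (B `\ y).
  case=> _ /(_ B (proj1 MB)) Beq.
  have BBy : B = B `\ y by apply: Beq; exact: subDsetl.
  have [_] : (B `\ y) y by rewrite -BBy.
  by apply.
have [x [B'x nBx MBx]] := matroid_I3 mM MBy nmax MB'.
have nJx : ~ J x by move/JB'.
have nBx' : ~ B x.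
  by move=> Bx; apply: nBx; split=> // xy; apply: nJx; rewrite xy.
have nXx : ~ X x by move=> Xx; apply: nJx; apply: XBJ.
apply: (notin_inclusion_maximal B1max (e := x)) => [/B1B//|].
split=> //; last by move=> z [/B1X//|->].
apply: (matroid_I2 mM) MBx _ => z [B1z|->]; last by right.
left; split; first exact: B1B.
by move=> zy; apply: (B1X _ B1z); rewrite zy; exact: JX.
Qed.

Lemma dual_is_matroid (E : Type) (M : set (set E)) :
  is_matroid M -> is_matroid (dual M).
Proof.
move=> mM; split.
- have [B [[MB _ _] Bmax]] := matroid_IM mM (matroid_I1 mM) (@sub0set _ setT).
  by exists B => //; split=> // C MC BC; apply: Bmax BC; split.
- by move=> I J [B MB JB] IJ; exists B => // x /IJ/JB.
- by move=> I I'; exact: dual_exchange.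
- exact: dual_IM.
Qed.

(** * Thin dependences and coindependent sets *)

Section ThinSums.
Variables (k : fieldType) (A E : Type) (f : E -> A -> k).

Lemma thin_dependence_subZ (c d : E -> k) (t : k) :
  thin_dependence f c -> thin_dependence f d ->
  thin_dependence f (fun e => c e - t * d e).
Proof.
move=> cf df a; have [cfin c0] := cf a; have [dfin d0] := df a.
pose S : set {classic E} :=
  [set e | c e * f e a != 0] `|` [set e | d e * f e a != 0].
have Sfin : finite_set S by rewrite finite_setU.
have outS (e : {classic E}) : ~ S e -> c e * f e a = 0 /\ d e * f e a = 0.
  by move=> /not_orP[/negP/negPn/eqP-> /negP/negPn/eqP->].
have addE (e : {classic E}) : (c e - t * d e) * f e a =
    c e * f e a + - t * (d e * f e a) by rewrite mulrBl mulNr mulrA.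
split.
  apply: sub_finite_set Sfin => e /= ne; apply: contrapT => /outS[ce de].
  by move: ne; rewrite addE ce de mulr0 addr0 eqxx.
(* The sum of two finitely supported families splits only once the summation
   range is finite. *)
have toS (g : {classic E} -> k) : (forall e, ~ S e -> g e = 0) ->
    \sum_(e \in [set: {classic E}]) g e = \sum_(e \in S) g e.
  by move=> g0; apply/esym/fsbig_widen => // e [_ /g0].
rewrite toS => [|e /outS[ce de]]; last by rewrite addE ce de mulr0 addr0.
rewrite toS in c0; last by move=> e /outS[].
rewrite toS in d0; last by move=> e /outS[].
under eq_fsbigr do rewrite addE.
by rewrite fsbig_split//= c0 -mulr_fsumr d0 mulr0 addr0.
Qed.

Lemma thin_dependence0 : thin_dependence f (fun=> 0).
Proof.
move=> a; split; last by apply: fsbig1 => e _; rewrite mul0r.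
apply: sub_finite_set (finite_set0 E) => e /=.
by rewrite mul0r eqxx.
Qed.

Lemma co_thin_sums0 : co_thin_sums f set0.
Proof. by []. Qed.

Lemma co_thin_sums_sub (I J : set E) :
  co_thin_sums f J -> I `<=` J -> co_thin_sums f I.
Proof.
move=> cJ IJ i /IJ/cJ[d [df di dJ]].
by exists d; split=> // j /IJ; exact: dJ.
Qed.

(** One step of Gaussian elimination: [d] serves as a pivot at [e]. *)
Lemma co_thin_sums_setU1 (I : set E) (d : E -> k) (e : E) :
  co_thin_sums f I -> thin_dependence f d -> (forall i, I i -> d i = 0) ->
  d e != 0 -> co_thin_sums f (I `|` [set e]).
Proof.
move=> cI df dI de.
have nIe : ~ I e by move=> /dI de0; rewrite de0 eqxx in de.
move=> i [Ii|->]; last first.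
  exists (fun x => 0 - (- (d e)^-1) * d x); split.
  - exact: thin_dependence_subZ thin_dependence0 df.
  - by rewrite mulNr opprK add0r mulVf.
  - move=> j [Ij _|-> /(_ erefl)//].
    by rewrite (dI _ Ij) mulr0 subr0.
have [c [cf ci cI0]] := cI i Ii.
exists (fun x => c x - c e / d e * d x); split.
- exact: thin_dependence_subZ.
- by rewrite (dI _ Ii) mulr0 subr0.
- move=> j [Ij|->] ji; last by rewrite divfK// subrr.
  by rewrite (dI _ Ij) mulr0 subr0 cI0.
Qed.

Lemma co_thin_sums_basesP (B : set E) :
  bases (co_thin_sums f) B <->
  co_thin_sums f B /\
  forall d, thin_dependence f d -> (forall i, B i -> d i = 0) ->
    forall e, d e = 0.
Proof.
split=> [Bmax|[cB Bspan]].
  split=> [|d df dB e]; first by case: Bmax.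
  apply/eqP/negPn/negP => de.
  apply: (notin_inclusion_maximal Bmax (e := e)).
    by move=> /dB de0; rewrite de0 eqxx in de.
  by apply: co_thin_sums_setU1 df dB de; case: Bmax.
apply: inclusion_maximal_setU1 cB _ => [I J|e nBe cBe].
  exact: co_thin_sums_sub.
have [d [df de dB]] := cBe e (or_intror erefl).
suff d0 : d e = 0 by move: de; rewrite d0 => /eqP; rewrite eq_sym oner_eq0.
apply: Bspan => // i Bi; apply: dB; first by left.
by move=> ie; apply: nBe; rewrite -ie.
Qed.

Lemma co_thin_sums_exchange (I I' : set E) :
  co_thin_sums f I -> ~ inclusion_maximal (co_thin_sums f) I ->
  inclusion_maximal (co_thin_sums f) I' ->
  exists x, [/\ I' x, ~ I x & co_thin_sums f (I `|` [set x])].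
Proof.
move=> cI nI /co_thin_sums_basesP[_ I'span].
apply: contrapT => nex; apply: nI; apply/co_thin_sums_basesP; split=> //.
move=> d df dI; apply: I'span => // x I'x.
apply/eqP/negPn/negP => dx; apply: nex; exists x; split=> //.
  by move=> /dI dx0; rewrite dx0 eqxx in dx.
exact: co_thin_sums_setU1 df dI dx.
Qed.

Lemma co_thin_sums_is_matroid :
  axiom_IM (co_thin_sums f) -> is_matroid (co_thin_sums f).
Proof.
move=> hIM; split=> //.
- exact: co_thin_sums_sub.
- exact: co_thin_sums_exchange.
Qed.

Lemma dual_co_thin_sums :
  axiom_IM (co_thin_sums f) -> dual (co_thin_sums f) = thin_sums f.
Proof.
move=> hIM; apply/seteqP; split=> X.
  move=> [B /co_thin_sums_basesP[_ Bspan] XB] [c [cf [e ce] cX]].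
  suff ce0 : c e = 0 by rewrite ce0 eqxx in ce.
  by apply: Bspan => // i Bi; apply: cX => /XB.
move=> indX.
have [B Bmax] := hIM _ (~` X) co_thin_sums0 (@sub0set _ _).
have [[cB _ BX] _] := Bmax.
exists B; last by move=> x Xx /BX.
apply/co_thin_sums_basesP; split=> // d df dB e.
apply: contrapT => de; apply: indX; exists d; split=> //.
  by exists e; apply/eqP.
move=> x nXx; apply/eqP/negPn/negP => dx.
apply: (notin_inclusion_maximal Bmax (e := x)).
  by move=> /dB dx0; rewrite dx0 eqxx in dx.
split=> //; last by move=> y [/BX//|->].
exact: co_thin_sums_setU1 df dB dx.
Qed.

End ThinSums.

Theorem theorem4p13 (k : fieldType) (A E : Type) (f : E -> A -> k)
  (hIM : axiom_IM (co_thin_sums f)) :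
  [/\ is_matroid (co_thin_sums f),
      dual (co_thin_sums f) = thin_sums f &
      is_matroid (thin_sums f)].
Proof.
have mM := co_thin_sums_is_matroid hIM.
split=> //; first exact: dual_co_thin_sums.
by rewrite -(dual_co_thin_sums hIM); exact: dual_is_matroid.
Qed.
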